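(* Let $\mathscr{E}$ be a regular category. The bicategory $\mathrm{Rel}\,\mathscr{E}$ of relations in $\mathscr{E}$ has tabulations from the terminal. Moreover, the class $\mathrm{Tab}$ (a calibration of $\mathrm{Rel}\,\mathscr{E}$) consists of those relations isomorphic to $p_*$ for some monomorphism $p$ in $\mathscr{E}$.
   Context: **Relations.** $\mathrm{Rel}\,\mathscr{E}$ is the locally ordered bicategory with the same objects as $\mathscr{E}$, whose morphisms $(r_1,R,r_2):X\to Y$ are jointly monomorphic spans $X\xleftarrow{r_1}R\xrightarrow{r_2}Y$ in $\mathscr{E}$, ordered by inclusion, with the usual composition of relations (pullback followed by image factorization). For a morphism $f:X\to Y$ of $\mathscr{E}$, $f_*=(1_X,X,f):X\to Y$ is its graph. **Tabulations from the terminal.** For a bicategory $\mathscr{M}$, let $\mathscr{M}_*$ be the sub-bicategory obtained by restricting to left adjoint morphisms. $\mathscr{M}$ has tabulations from the terminal when: (i) the bicategory $\mathscr{M}_*$ has a (bicategorical) terminal object $1$ such that, for all objects $U$, the unique-up-to-isomorphism left-adjoint morphism $!_U:U\to1$ is terminal in the category $\mathscr{M}(U,1)$; (ii) each morphism $u:1\to X$ in $\mathscr{M}$ has a tabulation. A tabulation of $u$ consists of an object $U$, a left adjoint morphism $p:U\to X$ (the right leg) and a 2-cell $\rho_u:p\Rightarrow u\,!_U$ such that, for all objects $K$, the natural transformation $\lambda$ from $\mathscr{M}(K,p)$ to the functor constant at $u\,!_K$, with component $pw\xRightarrow{\rho_uw}u\,!_U\,w\xRightarrow{u!}u\,!_K$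 at $w\in\mathscr{M}(K,U)$ (where $!$ denotes the unique 2-cell $!_Uw\Rightarrow{!_K}$), exhibits $\mathscr{M}(K,U)$ as a bicategorical comma object in $\mathrm{Cat}$ of the identity functor of $\mathscr{M}(K,X)$ and $u\,!_K:\mathbf{1}\to\mathscr{M}(K,X)$; that is, the induced functor $\mathscr{M}(K,U)\to\mathscr{M}(K,X)/(u\,!_K)$ into the slice category is an equivalence. $\mathrm{Tab}$ is the class of all morphisms $p:U\to X$ occurring as the right leg of a tabulation of some $u:1\to X$. (The paper proves that $\mathrm{Tab}$ is always a calibration when $\mathscr{M}$ has tabulations from the terminal; the meaning of ''calibration'' is not needed for the claim, which identifies the class $\mathrm{Tab}$.) *)

(* Defs.v *)
From Stdlib Require Import ClassicalEpsilon.

Set Implicit Arguments.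
Unset Strict Implicit.

Declare Scope cat_scope.
Delimit Scope cat_scope with cat.
Local Open Scope cat_scope.

(** * Categories *)

Record Category := {
  ob :> Type;
  hom : ob -> ob -> Type;
  idm : forall X, hom X X;
  comp : forall X Y Z, hom Y Z -> hom X Y -> hom X Z;
  comp_idl : forall X Y (f : hom X Y), comp (idm Y) f = f;
  comp_idr : forall X Y (f : hom X Y), comp f (idm X) = f;
  comp_assoc : forall X Y Z W (h : hom Z W) (g : hom Y Z) (f : hom X Y),
      comp h (comp g f) = comp (comp h g) f }.

Arguments hom {c} X Y.
Arguments idm {c} X.
Arguments comp {c X Y Z} g f.

Notation "X ~> Y" := (hom X Y) (at level 99, Y at level 200) : cat_scope.
Notation "g ∘ f" := (comp g f) (at level 40, left associativity) : cat_scope.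

Definition is_iso {C : Category} {X Y : C} (f : X ~> Y) : Prop :=
  exists g : Y ~> X, g ∘ f = idm X /\ f ∘ g = idm Y.

Definition isomorphic {C : Category} (X Y : C) : Prop :=
  exists f : X ~> Y, is_iso f.

Definition is_mono {C : Category} {X Y : C} (f : X ~> Y) : Prop :=
  forall T (a b : T ~> X), f ∘ a = f ∘ b -> a = b.

Definition is_terminal {C : Category} (t : C) : Prop :=
  forall X : C, exists! f : X ~> t, True.

Record Functor (C D : Category) := {
  fob :> C -> D;
  fmap : forall X Y : C, (X ~> Y) -> (fob X ~> fob Y);
  fmap_id : forall X : C, fmap (idm X) = idm (fob X);
  fmap_comp : forall (X Y Z : C) (g : Y ~> Z) (f : X ~> Y),
      fmap (g ∘ f) = fmap g ∘ fmap f }.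

Arguments fmap {C D} _ {X Y} _.

Program Definition id_functor (C : Category) : Functor C C :=
  {| fob := fun X => X; fmap := fun _ _ f => f |}.

Program Definition comp_functor {C D B : Category}
    (G : Functor D B) (F : Functor C D) : Functor C B :=
  {| fob := fun X => G (F X); fmap := fun _ _ f => fmap G (fmap F f) |}.
Next Obligation. now rewrite !fmap_id. Qed.
Next Obligation. now rewrite !fmap_comp. Qed.

Record NatTrans {C D : Category} (F G : Functor C D) := {
  ntr :> forall X : C, F X ~> G X;
  ntr_nat : forall (X Y : C) (f : X ~> Y), ntr Y ∘ fmap F f = fmap G f ∘ ntr X }.

Definition naturally_isomorphic {C D : Category} (F G : Functor C D) : Prop :=
  exists eta : NatTrans F G, forall X, is_iso (eta X).

Definition is_equivalence {C D : Category} (F : Functor C D) : Prop :=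
  exists G : Functor D C,
    naturally_isomorphic (comp_functor G F) (id_functor C) /\
    naturally_isomorphic (comp_functor F G) (id_functor D).

Program Definition terminal_category : Category :=
  {| ob := unit; hom := fun _ _ => unit; idm := fun _ => tt;
     comp := fun _ _ _ _ _ => tt |}.
Next Obligation. now destruct f. Qed.
Next Obligation. now destruct f. Qed.

Program Definition to_terminal_category (C : Category) :
    Functor C terminal_category :=
  {| fob := fun _ => tt; fmap := fun _ _ _ => tt |}.

Program Definition full_subcategory (C : Category) (P : C -> Prop) : Category :=
  {| ob := { X : C | P X };
     hom := fun X Y => proj1_sig X ~> proj1_sig Y;
     idm := fun X => idm (proj1_sig X);
     comp := fun _ _ _ g f => g ∘ f |}.
Next Obligation. apply comp_idl. Qed.
Next Obligation. apply comp_idr. Qed.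
Next Obligation. apply comp_assoc. Qed.

Lemma sig_ext {A : Type} {P : A -> Prop} (u v : {x | P x}) :
  proj1_sig u = proj1_sig v -> u = v.
Proof.
  destruct u as [x p], v as [y q]; simpl; intros <-.
  now rewrite (proof_irrelevance _ p q).
Qed.

Record slice_ob (C : Category) (X : C) := Slice {
  slice_dom : C;
  slice_arr : slice_dom ~> X }.

Program Definition slice (C : Category) (X : C) : Category :=
  {| ob := slice_ob X;
     hom := fun a b =>
       { h : slice_dom a ~> slice_dom b | slice_arr b ∘ h = slice_arr a };
     idm := fun a => exist _ (idm (slice_dom a)) _;
     comp := fun _ _ _ g f => exist _ (proj1_sig g ∘ proj1_sig f) _ |}.
Next Obligation. apply comp_idr. Qed.
Next Obligation. now rewrite comp_assoc. Qed.
Next Obligation. apply sig_ext, comp_idl. Qed.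
Next Obligation. apply sig_ext, comp_idr. Qed.
Next Obligation. apply sig_ext, comp_assoc. Qed.

(** * Bicategories *)

(** [bcomp2] is horizontal composition of 2-cells; [bcomp2_id] and [bcomp2_comp]
    say that [bcomp1], [bcomp2] form a functor
    [bhom Y Z * bhom X Y -> bhom X Z]. *)

Record Bicategory := {
  bob :> Type;
  bhom : bob -> bob -> Category;
  bid : forall X, bhom X X;
  bcomp1 : forall X Y Z, bhom Y Z -> bhom X Y -> bhom X Z;
  bcomp2 : forall X Y Z (g g' : bhom Y Z) (f f' : bhom X Y),
      (g ~> g') -> (f ~> f') -> (bcomp1 g f ~> bcomp1 g' f');
  bcomp2_id : forall X Y Z (g : bhom Y Z) (f : bhom X Y),
      bcomp2 (idm g) (idm f) = idm (bcomp1 g f);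
  bcomp2_comp : forall X Y Z (g g' g'' : bhom Y Z) (f f' f'' : bhom X Y)
      (b' : g' ~> g'') (b : g ~> g') (a' : f' ~> f'') (a : f ~> f'),
      bcomp2 (b' ∘ b) (a' ∘ a) = bcomp2 b' a' ∘ bcomp2 b a;

  lunit : forall X Y (f : bhom X Y), bcomp1 (bid Y) f ~> f;
  lunit_inv : forall X Y (f : bhom X Y), f ~> bcomp1 (bid Y) f;
  lunit_invl : forall X Y (f : bhom X Y), lunit_inv f ∘ lunit f = idm _;
  lunit_invr : forall X Y (f : bhom X Y), lunit f ∘ lunit_inv f = idm _;
  lunit_nat : forall X Y (f f' : bhom X Y) (a : f ~> f'),
      lunit f' ∘ bcomp2 (idm (bid Y)) a = a ∘ lunit f;

  runit : forall X Y (f : bhom X Y), bcomp1 f (bid X) ~> f;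
  runit_inv : forall X Y (f : bhom X Y), f ~> bcomp1 f (bid X);
  runit_invl : forall X Y (f : bhom X Y), runit_inv f ∘ runit f = idm _;
  runit_invr : forall X Y (f : bhom X Y), runit f ∘ runit_inv f = idm _;
  runit_nat : forall X Y (f f' : bhom X Y) (a : f ~> f'),
      runit f' ∘ bcomp2 a (idm (bid X)) = a ∘ runit f;

  assoc : forall X Y Z W (h : bhom Z W) (g : bhom Y Z) (f : bhom X Y),
      bcomp1 (bcomp1 h g) f ~> bcomp1 h (bcomp1 g f);
  assoc_inv : forall X Y Z W (h : bhom Z W) (g : bhom Y Z) (f : bhom X Y),
      bcomp1 h (bcomp1 g f) ~> bcomp1 (bcomp1 h g) f;
  assoc_invl : forall X Y Z W (h : bhom Z W) (g : bhom Y Z) (f : bhom X Y),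
      assoc_inv h g f ∘ assoc h g f = idm _;
  assoc_invr : forall X Y Z W (h : bhom Z W) (g : bhom Y Z) (f : bhom X Y),
      assoc h g f ∘ assoc_inv h g f = idm _;
  assoc_nat : forall X Y Z W (h h' : bhom Z W) (g g' : bhom Y Z) (f f' : bhom X Y)
      (c : h ~> h') (b : g ~> g') (a : f ~> f'),
      assoc h' g' f' ∘ bcomp2 (bcomp2 c b) a =
      bcomp2 c (bcomp2 b a) ∘ assoc h g f;

  triangle : forall X Y Z (g : bhom Y Z) (f : bhom X Y),
      bcomp2 (idm g) (lunit f) ∘ assoc g (bid Y) f = bcomp2 (runit g) (idm f);
  pentagon : forall X Y Z W V
      (k : bhom W V) (h : bhom Z W) (g : bhom Y Z) (f : bhom X Y),
      bcomp2 (idm k) (assoc h g f) ∘ assoc k (bcomp1 h g) f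
        ∘ bcomp2 (assoc k h g) (idm f) =
      assoc k h (bcomp1 g f) ∘ assoc (bcomp1 k h) g f }.

Arguments bhom {_} X Y.
Arguments bid {_} X.
Arguments bcomp1 {_ X Y Z} g f.
Arguments bcomp2 {_ X Y Z g g' f f'} _ _.
Arguments lunit {_ X Y} f.
Arguments lunit_inv {_ X Y} f.
Arguments runit {_ X Y} f.
Arguments runit_inv {_ X Y} f.
Arguments assoc {_ X Y Z W} h g f.
Arguments assoc_inv {_ X Y Z W} h g f.

Notation "g ⊙ f" := (bcomp1 g f) (at level 40, left associativity) : cat_scope.
Notation "b ⊛ a" := (bcomp2 b a) (at level 39, left associativity) : cat_scope.

(** [left_adjoint f]: there are [g], a unit [1 => g f] and a counit [f g => 1]
    satisfying the two triangle identities. *)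
Definition left_adjoint {M : Bicategory} {X Y : M} (f : bhom X Y) : Prop :=
  exists (g : bhom Y X) (eta : bid X ~> g ⊙ f) (eps : f ⊙ g ~> bid Y),
    lunit f ∘ (eps ⊛ idm f) ∘ assoc_inv f g f ∘ (idm f ⊛ eta) ∘ runit_inv f
      = idm f /\
    runit g ∘ (idm g ⊛ eps) ∘ assoc g f g ∘ (eta ⊛ idm g) ∘ lunit_inv g
      = idm g.

(** The hom-category from [X] to [Y] of the locally full sub-bicategory of left
    adjoints. *)
Definition ladj_hom {M : Bicategory} (X Y : M) : Category :=
  full_subcategory (C := bhom X Y) (fun f => left_adjoint f).

Definition bicat_terminal_in_ladj {M : Bicategory} (t : M) : Prop :=
  forall U : M, is_equivalence (to_terminal_category (ladj_hom U t)).

(** ** Tabulations from the terminal *)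

(** [bang U] is unique up to isomorphism, by [tob_terminal]. *)
Record TabTerminal (M : Bicategory) := {
  tob :> M;
  bang : forall U : M, bhom U tob;
  tob_terminal : bicat_terminal_in_ladj tob;
  bang_ladj : forall U, left_adjoint (bang U);
  bang_terminal : forall U, is_terminal (bang U) }.

Arguments bang {M} t U.
Arguments bang_terminal {M} t U.

Section Tabulations.
Context {M : Bicategory} (I : TabTerminal M).

Definition bang_cell {U : M} (f : bhom U I) : f ~> bang I U :=
  proj1_sig (constructive_indefinite_description _ (bang_terminal I U f)).

Lemma bang_cell_unique {U : M} (f : bhom U I) (a b : f ~> bang I U) : a = b.
Proof.
  destruct (bang_terminal I U f) as [c [_ Hc]].
  now rewrite <- (Hc a Logic.I), <- (Hc b Logic.I).
Qed.

Section Lambda.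
Context {X U : M} {u : bhom (tob I) X} {p : bhom U X} (rho : p ~> u ⊙ bang I U).
Context (K : M).

Definition lambda (w : bhom K U) : p ⊙ w ~> u ⊙ bang I K :=
  (idm u ⊛ bang_cell (bang I U ⊙ w)) ∘ assoc u (bang I U) w ∘ (rho ⊛ idm w).

Lemma lambda_natural (w w' : bhom K U) (a : w ~> w') :
  lambda w' ∘ (idm p ⊛ a) = lambda w.
Proof.
  unfold lambda.
  rewrite <- comp_assoc, <- bcomp2_comp, comp_idl, comp_idr.
  replace (rho ⊛ a) with (((idm u ⊛ idm (bang I U)) ⊛ a) ∘ (rho ⊛ idm w)).
  - rewrite comp_assoc, <- (comp_assoc _ (assoc _ _ _)), assoc_nat.
    rewrite comp_assoc, <- bcomp2_comp, comp_idl.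
    now rewrite (bang_cell_unique (_ ∘ _) (bang_cell (bang I U ⊙ w))).
  - now rewrite bcomp2_id, <- bcomp2_comp, comp_idl, comp_idr.
Qed.

(** The functor into the slice category induced by [lambda]; the slice is the
    comma category of the identity and the constant at [u !_K]. *)
Program Definition tabulation_functor :
    Functor (bhom K U) (slice (u ⊙ bang I K)) :=
  {| fob := fun w => Slice (lambda w) : slice (u ⊙ bang I K);
     fmap := fun w w' a => exist _ (idm p ⊛ a) (lambda_natural a) |}.
Next Obligation. apply sig_ext, bcomp2_id. Qed.
Next Obligation.
  apply sig_ext; simpl. now rewrite <- bcomp2_comp, comp_idl.
Qed.

End Lambda.

Definition is_tabulation {X U : M} (u : bhom (tob I) X) (p : bhom U X)
    (rho : p ~> u ⊙ bang I U) : Prop :=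
  left_adjoint p /\ forall K : M, is_equivalence (tabulation_functor rho K).

Definition has_tabulation {X : M} (u : bhom (tob I) X) : Prop :=
  exists (U : M) (p : bhom U X) (rho : p ~> u ⊙ bang I U), is_tabulation rho.

Definition Tab {U X : M} (p : bhom U X) : Prop :=
  exists (u : bhom (tob I) X) (rho : p ~> u ⊙ bang I U), is_tabulation rho.

End Tabulations.

Definition has_tabulations_from_terminal (M : Bicategory) : Prop :=
  exists I : TabTerminal M, forall (X : M) (u : bhom (tob I) X), has_tabulation u.

(** * Regular categories *)

Section Regular.
Context {E : Category}.

Definition is_pullback {X Y Z P : E} (f : X ~> Z) (g : Y ~> Z)
    (p1 : P ~> X) (p2 : P ~> Y) : Prop :=
  f ∘ p1 = g ∘ p2 /\
  forall T (a : T ~> X) (b : T ~> Y), f ∘ a = g ∘ b ->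
    exists! h : T ~> P, p1 ∘ h = a /\ p2 ∘ h = b.

Definition is_product {X Y P : E} (p1 : P ~> X) (p2 : P ~> Y) : Prop :=
  forall T (a : T ~> X) (b : T ~> Y),
    exists! h : T ~> P, p1 ∘ h = a /\ p2 ∘ h = b.

Definition is_coequalizer {W X Q : E} (a b : W ~> X) (q : X ~> Q) : Prop :=
  q ∘ a = q ∘ b /\
  forall T (h : X ~> T), h ∘ a = h ∘ b -> exists! k : Q ~> T, k ∘ q = h.

Definition is_regular_epi {X Q : E} (q : X ~> Q) : Prop :=
  exists (W : E) (a b : W ~> X), is_coequalizer a b q.

Definition is_image {X Y I : E} (f : X ~> Y) (q : X ~> I) (m : I ~> Y) : Prop :=
  is_regular_epi q /\ is_mono m /\ m ∘ q = f.

Definition jointly_mono {R X Y : E} (r1 : R ~> X) (r2 : R ~> Y) : Prop :=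
  forall T (a b : T ~> R), r1 ∘ a = r1 ∘ b -> r2 ∘ a = r2 ∘ b -> a = b.

End Regular.

Record regular (E : Category) : Prop := {
  reg_terminal : exists t : E, is_terminal t;
  reg_pullback : forall (X Y Z : E) (f : X ~> Z) (g : Y ~> Z),
      exists (P : E) (p1 : P ~> X) (p2 : P ~> Y), is_pullback f g p1 p2;
  reg_coequalizer : forall (X Y K : E) (f : X ~> Y) (k1 k2 : K ~> X),
      is_pullback f f k1 k2 ->
      exists (Q : E) (q : X ~> Q), is_coequalizer k1 k2 q;
  reg_stable : forall (X Y Z P : E) (f : X ~> Z) (g : Y ~> Z)
      (p1 : P ~> X) (p2 : P ~> Y),
      is_pullback f g p1 p2 -> is_regular_epi f -> is_regular_epi p2 }.

Section RegularFacts.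
Context {E : Category}.

Lemma regular_epi_epi {X Q : E} (q : X ~> Q) : is_regular_epi q ->
  forall T (a b : Q ~> T), a ∘ q = b ∘ q -> a = b.
Proof.
  intros (W & c & d & Hq & Hu) T a b Hab.
  destruct (Hu T (a ∘ q)) as [k [_ Hk]].
  { now rewrite <- !comp_assoc, Hq. }
  now rewrite <- (Hk a eq_refl), <- (Hk b (eq_sym Hab)).
Qed.

Context (HE : regular E).

Lemma product_exists (X Y : E) :
  exists (P : E) (p1 : P ~> X) (p2 : P ~> Y), is_product p1 p2.
Proof.
  destruct (reg_terminal HE) as [t Ht].
  destruct (Ht X) as [x _], (Ht Y) as [y _].
  destruct (reg_pullback HE x y) as (P & p1 & p2 & _ & HP).
  exists P, p1, p2. intros T a b. apply HP.
  destruct (Ht T) as [c [_ Hc]].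
  now rewrite <- (Hc (x ∘ a) Logic.I), <- (Hc (y ∘ b) Logic.I).
Qed.

Lemma image_exists (X Y : E) (f : X ~> Y) :
  exists (I : E) (q : X ~> I) (m : I ~> Y), is_image f q m.
Proof.
  destruct (reg_pullback HE f f) as (K & k1 & k2 & HK).
  destruct (reg_coequalizer HE HK) as (I & q & Hq).
  assert (Rq : is_regular_epi q) by (exists K, k1, k2; exact Hq).
  destruct (proj2 Hq Y f (proj1 HK)) as [m [Hm _]].
  exists I, q, m. split; [exact Rq | split; [| exact Hm]].
  intros T a b Hab.
  (* cover [T] so that both [a] and [b] lift to [X] *)
  destruct (reg_pullback HE q a) as (A & a1 & a2 & HA).
  destruct (reg_pullback HE q (b ∘ a2)) as (B & b1 & b2 & HB).
  pose proof (reg_stable HE HA Rq) as Ra.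
  pose proof (reg_stable HE HB Rq) as Rb.
  apply (regular_epi_epi Ra), (regular_epi_epi Rb).
  destruct HA as [HA _], HB as [HB _].
  destruct (proj2 HK B (a1 ∘ b2) b1) as [h [[H1 H2] _]].
  { rewrite <- Hm, <- !comp_assoc, HB, (comp_assoc q), HA, !comp_assoc.
    now rewrite Hab. }
  rewrite <- HA, <- HB, <- comp_assoc, <- H1, <- H2, !comp_assoc.
  now rewrite (proj1 Hq).
Qed.

End RegularFacts.

(** * Relations *)

Record Relation {E : Category} (X Y : E) := {
  rel_ob : E;
  rel1 : rel_ob ~> X;
  rel2 : rel_ob ~> Y;
  rel_mono : jointly_mono rel1 rel2 }.

Definition rel_le {E : Category} {X Y : E} (r s : Relation X Y) : Prop :=
  exists h : rel_ob r ~> rel_ob s, rel1 s ∘ h = rel1 r /\ rel2 s ∘ h = rel2 r.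

Program Definition graph {E : Category} {X Y : E} (f : X ~> Y) : Relation X Y :=
  {| rel_ob := X; rel1 := idm X; rel2 := f |}.
Next Obligation. intros T a b H _. now rewrite !comp_idl in H. Qed.

Section RelComposition.
Context {E : Category} (HE : regular E).

(** The data of a composite: the pullback [P] of [rel2 r] and [rel1 s], and the
    image of the induced [P -> X * Z]. *)
Definition is_composite {X Y Z : E} (s : Relation Y Z) (r : Relation X Y)
    (t : Relation X Z) : Prop :=
    exists (P : E) (p1 : P ~> rel_ob r) (p2 : P ~> rel_ob s)
      (XZ : E) (pr1 : XZ ~> X) (pr2 : XZ ~> Z)
      (f : P ~> XZ) (q : P ~> rel_ob t) (m : rel_ob t ~> XZ),
      is_pullback (rel2 r) (rel1 s) p1 p2 /\
      is_product pr1 pr2 /\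
      pr1 ∘ f = rel1 r ∘ p1 /\ pr2 ∘ f = rel2 s ∘ p2 /\
      is_image f q m /\
      rel1 t = pr1 ∘ m /\ rel2 t = pr2 ∘ m.

Lemma composite_exists {X Y Z : E} (s : Relation Y Z) (r : Relation X Y) :
  exists t, is_composite s r t.
Proof.
  destruct (reg_pullback HE (rel2 r) (rel1 s)) as (P & p1 & p2 & HP).
  destruct (product_exists HE X Z) as (XZ & pr1 & pr2 & HXZ).
  destruct (HXZ P (rel1 r ∘ p1) (rel2 s ∘ p2)) as [f [[Hf1 Hf2] _]].
  destruct (image_exists HE f) as (I & q & m & Hm).
  assert (J : jointly_mono (pr1 ∘ m) (pr2 ∘ m)).
  { intros T a b Ha Hb. destruct Hm as (_ & Hm & _). apply Hm.
    destruct (HXZ T (pr1 ∘ (m ∘ a)) (pr2 ∘ (m ∘ a))) as [c [_ Hc]].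
    rewrite <- (Hc (m ∘ a)), <- (Hc (m ∘ b)); auto.
    now rewrite !comp_assoc, Ha, Hb. }
  exists {| rel_mono := J |}.
  exists P, p1, p2, XZ, pr1, pr2, f, q, m. auto 10.
Qed.

Definition rel_comp {X Y Z : E} (s : Relation Y Z) (r : Relation X Y) :
    Relation X Z :=
  proj1_sig (constructive_indefinite_description _ (composite_exists s r)).

Lemma rel_comp_spec {X Y Z : E} (s : Relation Y Z) (r : Relation X Y) :
  is_composite s r (rel_comp s r).
Proof. apply (proj2_sig (constructive_indefinite_description _ _)). Qed.

(** Membership of a generalized element in a relation. *)
Definition rel_in {X Y T : E} (r : Relation X Y) (x : T ~> X) (y : T ~> Y) : Prop :=
  exists h : T ~> rel_ob r, rel1 r ∘ h = x /\ rel2 r ∘ h = y.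

Lemma rel_le_in {X Y : E} (r s : Relation X Y) :
  rel_le r s <->
  forall T (x : T ~> X) (y : T ~> Y), rel_in r x y -> rel_in s x y.
Proof.
  split.
  - intros (h & H1 & H2) T x y (k & <- & <-).
    exists (h ∘ k). now rewrite !comp_assoc, H1, H2.
  - intros H. apply H. exists (idm _). now rewrite !comp_idr.
Qed.

Lemma rel_in_cover {X Y T T' : E} (r : Relation X Y) (x : T ~> X) (y : T ~> Y)
    (e : T' ~> T) :
  is_regular_epi e -> rel_in r (x ∘ e) (y ∘ e) -> rel_in r x y.
Proof.
  intros He (h & H1 & H2). pose proof (regular_epi_epi He) as Ee.
  destruct He as (W & a & b & Hab & Hu).
  destruct (Hu _ h) as [k [Hk _]].
  { apply (rel_mono (r := r));
      rewrite !comp_assoc, ?H1, ?H2, <- !comp_assoc; now rewrite Hab. }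
  exists k. split; apply Ee; now rewrite <- comp_assoc, Hk.
Qed.

Lemma rel_in_comp {X Y Z T : E} (s : Relation Y Z) (r : Relation X Y)
    (x : T ~> X) (z : T ~> Z) :
  rel_in (rel_comp s r) x z <->
  exists (T' : E) (e : T' ~> T) (y : T' ~> Y),
    is_regular_epi e /\ rel_in r (x ∘ e) y /\ rel_in s y (z ∘ e).
Proof.
  destruct (rel_comp_spec s r)
    as (P & p1 & p2 & XZ & pr1 & pr2 & f & q & m & HP & _ & F1 & F2
         & (Rq & _ & Hq) & E1 & E2).
  rewrite <- Hq, comp_assoc, <- E1 in F1.
  rewrite <- Hq, comp_assoc, <- E2 in F2.
  split.
  - intros (h & <- & <-).
    destruct (reg_pullback HE q h) as (T' & t & e & HT).
    exists T', e, (rel2 r ∘ (p1 ∘ t)).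
    split; [exact (reg_stable HE HT Rq) | split].
    + exists (p1 ∘ t). split; [| reflexivity].
      now rewrite <- comp_assoc, <- (proj1 HT), !comp_assoc, F1.
    + exists (p2 ∘ t). split.
      * now rewrite !comp_assoc, (proj1 HP).
      * now rewrite <- (comp_assoc (rel2 _) h), <- (proj1 HT), !comp_assoc, F2.
  - intros (T' & e & y & He & (h & H1 & H2) & (k & K1 & K2)).
    apply (rel_in_cover He).
    destruct (proj2 HP T' h k) as [l [[L1 L2] _]]; [congruence |].
    exists (q ∘ l). rewrite !comp_assoc, F1, F2, <- !comp_assoc, L1, L2. auto.
Qed.

Lemma idm_regular_epi (X : E) : is_regular_epi (idm X).
Proof.
  exists X, (idm X), (idm X). split; [reflexivity |].
  intros T h _. exists h. split; [apply comp_idr |].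
  intros k <-. apply comp_idr.
Qed.

Lemma rel_in_precomp {X Y T T' : E} (r : Relation X Y) (x : T ~> X) (y : T ~> Y)
    (e : T' ~> T) : rel_in r x y -> rel_in r (x ∘ e) (y ∘ e).
Proof.
  intros (h & <- & <-). exists (h ∘ e). now rewrite !comp_assoc.
Qed.

Lemma rel_in_comp_intro {X Y Z T : E} (s : Relation Y Z) (r : Relation X Y)
    (x : T ~> X) (y : T ~> Y) (z : T ~> Z) :
  rel_in r x y -> rel_in s y z -> rel_in (rel_comp s r) x z.
Proof.
  intros Hr Hs. apply rel_in_comp. exists T, (idm T), y.
  rewrite !comp_idr. auto using idm_regular_epi.
Qed.

Lemma rel_in_graph {X Y T : E} (f : X ~> Y) (x : T ~> X) (y : T ~> Y) :
  rel_in (graph f) x y <-> f ∘ x = y.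
Proof.
  split.
  - intros (h & H1 & H2). simpl in *. rewrite comp_idl in H1. now subst.
  - intros <-. exists x. simpl. now rewrite comp_idl.
Qed.

Lemma rel_le_refl {X Y : E} (r : Relation X Y) : rel_le r r.
Proof. apply rel_le_in. auto. Qed.

Lemma rel_le_trans {X Y : E} (r s t : Relation X Y) :
  rel_le s t -> rel_le r s -> rel_le r t.
Proof. rewrite !rel_le_in. auto. Qed.

Lemma rel_comp_mono {X Y Z : E} (s s' : Relation Y Z) (r r' : Relation X Y) :
  rel_le s s' -> rel_le r r' -> rel_le (rel_comp s r) (rel_comp s' r').
Proof.
  rewrite !rel_le_in. intros Hs Hr T x z.
  rewrite !rel_in_comp. intros (T' & e & y & He & H1 & H2).
  exists T', e, y. auto.
Qed.

Lemma rel_lunit {X Y : E} (r : Relation X Y) :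
  rel_le (rel_comp (graph (idm Y)) r) r.
Proof.
  apply rel_le_in. intros T x y. rewrite rel_in_comp.
  intros (T' & e & y' & He & H1 & H2). apply rel_in_graph in H2.
  rewrite comp_idl in H2. subst. exact (rel_in_cover He H1).
Qed.

Lemma rel_lunit_inv {X Y : E} (r : Relation X Y) :
  rel_le r (rel_comp (graph (idm Y)) r).
Proof.
  apply rel_le_in. intros T x y H. apply (rel_in_comp_intro H).
  apply rel_in_graph, comp_idl.
Qed.

Lemma rel_runit {X Y : E} (r : Relation X Y) :
  rel_le (rel_comp r (graph (idm X))) r.
Proof.
  apply rel_le_in. intros T x y. rewrite rel_in_comp.
  intros (T' & e & x' & He & H1 & H2). apply rel_in_graph in H1.
  rewrite comp_idl in H1. subst. exact (rel_in_cover He H2).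
Qed.

Lemma rel_runit_inv {X Y : E} (r : Relation X Y) :
  rel_le r (rel_comp r (graph (idm X))).
Proof.
  apply rel_le_in. intros T x y H. refine (rel_in_comp_intro _ H).
  apply rel_in_graph, comp_idl.
Qed.

Lemma rel_assoc {X Y Z W : E}
    (t : Relation Z W) (s : Relation Y Z) (r : Relation X Y) :
  rel_le (rel_comp (rel_comp t s) r) (rel_comp t (rel_comp s r)).
Proof.
  apply rel_le_in. intros T x w. rewrite rel_in_comp.
  intros (T1 & e & y & He & Hr & Hts). apply (rel_in_cover He).
  apply rel_in_comp in Hts. destruct Hts as (T2 & d & z & Hd & Hs & Ht).
  apply (rel_in_cover Hd). refine (rel_in_comp_intro _ Ht).
  refine (rel_in_comp_intro _ Hs). now apply rel_in_precomp.
Qed.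

Lemma rel_assoc_inv {X Y Z W : E}
    (t : Relation Z W) (s : Relation Y Z) (r : Relation X Y) :
  rel_le (rel_comp t (rel_comp s r)) (rel_comp (rel_comp t s) r).
Proof.
  apply rel_le_in. intros T x w. rewrite rel_in_comp.
  intros (T1 & e & z & He & Hsr & Ht). apply (rel_in_cover He).
  apply rel_in_comp in Hsr. destruct Hsr as (T2 & d & y & Hd & Hr & Hs).
  apply (rel_in_cover Hd). apply (rel_in_comp_intro Hr).
  apply (rel_in_comp_intro Hs). now apply rel_in_precomp.
Qed.

(** 2-cells are proofs of inclusion, so all equations between them hold by proof
    irrelevance. *)
Definition Rel_hom (X Y : E) : Category :=
  {| ob := Relation X Y;
     hom := fun r s => rel_le r s;
     idm := @rel_le_refl X Y;
     comp := fun r s t => @rel_le_trans X Y r s t;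
     comp_idl := fun _ _ _ => proof_irrelevance _ _ _;
     comp_idr := fun _ _ _ => proof_irrelevance _ _ _;
     comp_assoc := fun _ _ _ _ _ _ _ => proof_irrelevance _ _ _ |}.

Lemma Rel_hom_irrelevance (X Y : E) (r s : Rel_hom X Y) (a b : r ~> s) : a = b.
Proof. exact (proof_irrelevance (rel_le r s) a b). Qed.

Definition Rel : Bicategory.
Proof.
  refine {| bob := E;
    bhom := Rel_hom;
    bid := fun X => graph (idm X) : Rel_hom X X;
    bcomp1 := fun X Y Z (s : Rel_hom Y Z) (r : Rel_hom X Y) =>
                rel_comp s r : Rel_hom X Z;
    bcomp2 := fun X Y Z s s' r r' b a => rel_comp_mono b a;
    lunit := fun X Y r => rel_lunit r;
    lunit_inv := fun X Y r => rel_lunit_inv r;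
    runit := fun X Y r => rel_runit r;
    runit_inv := fun X Y r => rel_runit_inv r;
    assoc := fun X Y Z W t s r => rel_assoc t s r;
    assoc_inv := fun X Y Z W t s r => rel_assoc_inv t s r |};
  intros; apply Rel_hom_irrelevance.
Defined.

End RelComposition.

(* Main.v *)
Require Import Defs.
Local Open Scope cat_scope.

(** Hom-categories of [Rel E] are preorders, so relations can be handled through
    their generalized elements.  Left adjoint relations are the total
    single-valued ones, hence graphs; so the object [1] of the definition is
    terminal in [E], every [!_U] is a graph, and a relation [u : 1 -> X] is a
    subobject [f : U -> X].  A relation [K -> X] lies below [u !_K] iff its second
    leg factors through [f], so [f_*] tabulates [u], with inverse functor
    [s |-> f^o s].  Conversely, if [f_*] is the right leg of a tabulation,
    composing with [f_*] reflects inclusion, and on graphs this says that [f] is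
    mono. *)

(** * Thin categories *)

Definition thin (C : Category) : Prop := forall (X Y : C) (f g : X ~> Y), f = g.

Lemma thin_slice (C : Category) (X : C) : thin C -> thin (slice X).
Proof. intros HC a b f g. apply sig_ext, HC. Qed.

(** Functor laws and naturality are free in thin categories. An object map [G] therefore suffices:
    it acts on arrows by conjugation with [from] and [to], followed by reflection along [F]. *)
Lemma thin_equivalence {C D : Category} (F : Functor C D) (G : D -> C)
    (to : forall d, F (G d) ~> d) (from : forall d, d ~> F (G d))
    (refl : forall X Y : C, (F X ~> F Y) -> (X ~> Y)) :
  thin C -> thin D -> is_equivalence F.
Proof.
  intros HC HD.
  unshelve eexists.
  { refine {| fob := G; fmap := fun d d' a => refl _ _ (from d' ∘ a ∘ to d) |};
      intros; apply HC. }
  split; (unshelve eexists; [unshelve econstructor |]); simpl.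
  - intros X. apply refl, to.
  - intros; apply HC.
  - intros X. exists (refl _ _ (from (F X))). split; apply HC.
  - exact to.
  - intros; apply HD.
  - intros d. exists (from d). split; apply HD.
Qed.

Lemma equivalence_reflects {C D : Category} (F : Functor C D) (X Y : C) :
  is_equivalence F -> (F X ~> F Y) -> inhabited (X ~> Y).
Proof.
  intros (G & (eta & Heta) & _) a.
  destruct (Heta X) as [i _].
  exact (inhabits (eta Y ∘ fmap G a ∘ i)).
Qed.

(** * Relations *)

Section Converse.
Context {E : Category}.

Program Definition converse {X Y : E} (r : Relation X Y) : Relation Y X :=
  {| rel_ob := rel_ob r; rel1 := rel2 r; rel2 := rel1 r |}.
Next Obligation. intros T a b H1 H2. now apply (rel_mono (r := r)). Qed.

Lemma rel_in_converse_graph {X Y T : E} (f : X ~> Y) (x : T ~> X) (y : T ~> Y) :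
  rel_in (converse (graph f)) y x <-> f ∘ x = y.
Proof.
  rewrite <- rel_in_graph.
  split; intros (h & H1 & H2); exists h; split; assumption.
Qed.

Lemma rel_in_le {X Y T : E} {r s : Relation X Y} {x : T ~> X} {y : T ~> Y} :
  rel_le r s -> rel_in r x y -> rel_in s x y.
Proof. intros H. apply rel_le_in. exact H. Qed.

Lemma graph_le_eq {X Y : E} (f g : X ~> Y) : rel_le (graph f) (graph g) -> f = g.
Proof.
  intros H. symmetry. rewrite <- (comp_idr g). apply rel_in_graph.
  apply (rel_in_le H), rel_in_graph, comp_idr.
Qed.

End Converse.

(** * Left adjoint relations and graphs *)

Section RelFacts.
Context {E : Category} (HE : regular E).

Lemma thin_Rel_hom (X Y : E) : thin (Rel_hom X Y).
Proof. intros r s. apply Rel_hom_irrelevance. Qed.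

(** The triangle identities equate 2-cells between relations, so they hold by irrelevance. *)
Lemma left_adjoint_iff {X Y : E} (r : Relation X Y) :
  @left_adjoint (Rel HE) X Y r <->
  exists g : Relation Y X,
    rel_le (graph (idm X)) (rel_comp HE g r) /\
    rel_le (rel_comp HE r g) (graph (idm Y)).
Proof.
  split.
  - intros (g & eta & eps & _). exists g. split; assumption.
  - intros (g & eta & eps). exists g, eta, eps.
    split; apply Rel_hom_irrelevance.
Qed.

(** The right adjoint is the converse of the graph: totality gives the unit, single-valuedness the
    counit. *)
Lemma left_adjoint_graph {X Y : E} (r : Relation X Y) (f : X ~> Y) :
  rel_le r (graph f) -> rel_le (graph f) r -> @left_adjoint (Rel HE) X Y r.
Proof.
  intros H1 H2. apply left_adjoint_iff. exists (converse (graph f)).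
  split; apply rel_le_in; intros T x y H.
  - apply rel_in_graph in H. rewrite comp_idl in H. subst y.
    apply (rel_in_comp_intro HE) with (y := f ∘ x).
    + now apply (rel_in_le H2), rel_in_graph.
    + now apply rel_in_converse_graph.
  - apply rel_in_comp in H. destruct H as (T' & e & z & He & Hg & Hr).
    apply (rel_in_cover He).
    apply (rel_in_le H1) in Hr.
    apply rel_in_converse_graph in Hg. apply rel_in_graph in Hr.
    apply rel_in_graph. rewrite comp_idl. congruence.
Qed.

Lemma left_adjoint_is_graph {X Y : E} {r : Relation X Y} :
  @left_adjoint (Rel HE) X Y r ->
  exists f : X ~> Y, rel_le r (graph f) /\ rel_le (graph f) r.
Proof.
  intros H. apply left_adjoint_iff in H. destruct H as (g & eta & eps).
  assert (Hgr : forall T (y y' : T ~> Y) x, rel_in g y x -> rel_in r x y' -> y = y').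
  { intros T y y' x Hg Hr. rewrite <- (comp_idl y).
    apply rel_in_graph, (rel_in_le eps). exact (rel_in_comp_intro HE Hg Hr). }
  (* The unit gives a value of [r] only on a cover of [T], together with its [g]-relation back to
     [x]. *)
  assert (Htot : forall T (x : T ~> X), exists T' (e : T' ~> T) y,
             is_regular_epi e /\ rel_in r (x ∘ e) y /\ rel_in g y (x ∘ e)).
  { intros T x. apply (rel_in_comp HE), (rel_in_le eta).
    apply rel_in_graph, comp_idl. }
  assert (Hsv : forall T (x : T ~> X) y y', rel_in r x y -> rel_in r x y' -> y = y').
  { intros T x y y' H1 H2.
    destruct (Htot T x) as (T' & e & z & He & _ & Hz).
    apply (regular_epi_epi He).
    transitivity z; [symmetry |];
      apply (Hgr _ _ _ _ Hz); now apply rel_in_precomp. }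
  destruct (Htot X (idm X)) as (T & e & y & He & Hr & _).
  rewrite comp_idl in Hr.
  (* The cover [e] coequalizes some [a] and [b]. As [e ∘ a = e ∘ b], single-valuedness forces
     [y ∘ a = y ∘ b], so [y] descends along [e]. *)
  assert (Hf : exists f, f ∘ e = y).
  { destruct He as (W & a & b & Hab & Hu).
    destruct (Hu Y y) as [f [Hf _]]; [| now exists f].
    apply (Hsv _ (e ∘ a)); [| rewrite Hab]; now apply rel_in_precomp. }
  destruct Hf as [f Hf]. exists f.
  assert (Hfr : rel_in r (idm X) f).
  { apply (rel_in_cover He). now rewrite comp_idl, Hf. }
  split; apply rel_le_in; intros S x z Hx.
  - apply rel_in_graph. refine (Hsv _ _ _ _ _ Hx).
    rewrite <- (comp_idl x) at 1. now apply rel_in_precomp.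
  - apply rel_in_graph in Hx. subst z.
    rewrite <- (comp_idl x) at 1. now apply rel_in_precomp.
Qed.

(** * The terminal object *)

Lemma terminal_arrow_eq {t T : E} (Ht : is_terminal t) (a b : T ~> t) : a = b.
Proof.
  destruct (Ht T) as [c [_ Hc]]. now rewrite <- (Hc a I), <- (Hc b I).
Qed.

Lemma le_graph_terminal {t U : E} (Ht : is_terminal t) (r : Relation U t)
    (f : U ~> t) : rel_le r (graph f).
Proof.
  apply rel_le_in. intros T x y _. apply rel_in_graph, (terminal_arrow_eq Ht).
Qed.

Lemma bang_graph (J : TabTerminal (Rel HE)) (U : E) :
  exists f : U ~> tob J,
    rel_le (bang J U) (graph f) /\ rel_le (graph f) (bang J U).
Proof. apply left_adjoint_is_graph, (bang_ladj J U). Qed.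

(** Since [bang J U] is the graph of some [f] and is terminal among relations, every [graph g] lies
    below [graph f], whence [g = f]. *)
Lemma tob_is_terminal (J : TabTerminal (Rel HE)) : @is_terminal E (tob J).
Proof.
  intros U. destruct (bang_graph J U) as (f & Hf & _).
  exists f. split; [exact I |]. intros g _.
  symmetry. apply graph_le_eq, (rel_le_trans Hf).
  destruct (bang_terminal J U (graph g)) as [h _]. exact h.
Qed.

Lemma rel_in_bang (J : TabTerminal (Rel HE)) (U T : E) (x : T ~> U)
    (y : T ~> tob J) : rel_in (bang J U) x y.
Proof.
  destruct (bang_graph J U) as (f & _ & Hf).
  apply (rel_in_le Hf), rel_in_graph, (terminal_arrow_eq (tob_is_terminal J)).
Qed.

Lemma TabTerminal_of_terminal {t : E} :
  is_terminal t -> inhabited (TabTerminal (Rel HE)).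
Proof.
  intros Ht.
  pose (b := fun U : E => graph (proj1_sig
    (ClassicalEpsilon.constructive_indefinite_description _ (Ht U)))).
  assert (Hb : forall U, @left_adjoint (Rel HE) U t (b U)).
  { intros U. eapply left_adjoint_graph; apply rel_le_refl. }
  constructor.
  refine (@Build_TabTerminal (Rel HE) t b _ Hb _).
  - intros U.
    refine (@thin_equivalence (@ladj_hom (Rel HE) U t) terminal_category _
              (fun _ => exist _ (b U) (Hb U)) (fun _ => tt) (fun _ => tt) _ _ _).
    (* Any two left adjoints into [t] are comparable: [s] contains a graph into [t], and such a
       graph contains every relation. *)
    + intros [r Hr] [s Hs] _. simpl.
      destruct (left_adjoint_is_graph Hs) as (f & _ & Hf).
      exact (rel_le_trans Hf (le_graph_terminal Ht r f)).
    + intros r s. apply Rel_hom_irrelevance.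
    + intros [] [] [] []. reflexivity.
  - intros U r. exists (le_graph_terminal Ht r _). split; [exact I |].
    intros ? _. apply Rel_hom_irrelevance.
Qed.

(** * Tabulations *)

Section Subobject.
Context (J : TabTerminal (Rel HE)) {U X : E} {f : U ~> X} (Hf : is_mono f)
  {u : Relation (tob J) X}
  (Hu : forall T (z : T ~> tob J) (x : T ~> X),
      rel_in u z x <-> exists h, f ∘ h = x).

Lemma rel_in_comp_bang (K T : E) (k : T ~> K) (x : T ~> X) :
  rel_in (rel_comp HE u (bang J K)) k x <-> exists h, f ∘ h = x.
Proof.
  destruct (tob_is_terminal J T) as [z _].
  split; intros H.
  - apply rel_in_comp in H. destruct H as (T' & e & y & He & _ & H).
    (* Only [x ∘ e] is known to factor through [f]. Rephrased by [Hu] as membership in [u], this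
       descends along the cover; the first component is irrelevant. *)
    apply (Hu T z), (rel_in_cover He), Hu. exact (proj1 (Hu _ _ _) H).
  - apply (rel_in_comp_intro HE) with (y := z); [apply rel_in_bang | now apply Hu].
Qed.

Lemma subobject_tabulation {p : Relation U X} :
  rel_le p (graph f) -> rel_le (graph f) p ->
  exists rho : rel_le p (rel_comp HE u (bang J U)),
    @is_tabulation (Rel HE) J X U u p rho.
Proof.
  intros Hpf Hfp.
  assert (Hp : forall T (z : T ~> U) x, rel_in p z x <-> f ∘ z = x).
  { intros T z x. rewrite <- rel_in_graph. split; now apply rel_in_le. }
  unshelve eexists.
  { apply rel_le_in. intros T z x H. apply rel_in_comp_bang.
    exists z. now apply Hp. }
  split; [now apply left_adjoint_graph with f |]. intros K.
  refine (@thin_equivalence (@bhom (Rel HE) K U)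
            (@slice (@bhom (Rel HE) K X) _) _
            (fun s => rel_comp HE (converse (graph f)) (slice_dom s)) _ _ _ _ _).
  (* Here [f_* f^o s] lies below [s], as [f] is single-valued. *)
  - intros [s Hs].
    refine (exist _ _ (@Rel_hom_irrelevance _ _ _ _ _ _ _)).
    apply rel_le_in. simpl. intros T k x H.
    apply rel_in_comp in H. destruct H as (T1 & e & z & He & H & Hz).
    apply rel_in_comp in H. destruct H as (T2 & d & y & Hd & H & Hy).
    apply Hp in Hz. apply rel_in_converse_graph in Hy.
    rewrite comp_assoc, Hz in Hy. subst y.
    exact (rel_in_cover He (rel_in_cover Hd H)).
  - intros [s Hs].
    refine (exist _ _ (@Rel_hom_irrelevance _ _ _ _ _ _ _)).
    apply rel_le_in. simpl. intros T k x H.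
    (* Being below [u !_K] makes [x] factor as [f ∘ h]; this [h] is the intermediate element. *)
    destruct (proj1 (rel_in_comp_bang _ _ k x) (rel_in_le Hs H)) as [h Hh].
    apply (rel_in_comp_intro HE) with (y := h); [| now apply Hp].
    apply (rel_in_comp_intro HE H). now apply rel_in_converse_graph.
  - intros w w' [H _]. simpl in H.
    apply rel_le_in. intros T k z Hw.
    assert (Hk : rel_in (rel_comp HE p w') k (f ∘ z)).
    { apply (rel_in_le H), (rel_in_comp_intro HE Hw). now apply Hp. }
    apply rel_in_comp in Hk. destruct Hk as (T' & e & y & He & Hy & Hz).
    (* Reflection of inclusion is where [f] must be mono: [f ∘ y = f ∘ (z ∘ e)] is cancelled. *)
    apply Hp in Hz. rewrite <- comp_assoc in Hz. apply Hf in Hz. subst y.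
    exact (rel_in_cover He Hy).
  - apply thin_Rel_hom.
  - apply thin_slice, thin_Rel_hom.
Qed.

End Subobject.

(** If [f ∘ a = f ∘ b], composing the graphs of [a] and [b] with [p] yields an inclusion; the
    tabulation equivalence reflects it, giving [a = b]. *)
Lemma tabulation_mono (J : TabTerminal (Rel HE)) {U X : E} {f : U ~> X}
    {u : Relation (tob J) X} {p : Relation U X}
    {rho : rel_le p (rel_comp HE u (bang J U))} :
  @is_tabulation (Rel HE) J X U u p rho ->
  rel_le p (graph f) -> rel_le (graph f) p -> is_mono f.
Proof.
  intros [_ Heq] Hpf Hfp T a b Hab.
  apply graph_le_eq.
  assert (H : rel_le (rel_comp HE p (graph a)) (rel_comp HE p (graph b))).
  { apply rel_le_in. intros S s x H.
    apply rel_in_comp in H. destruct H as (S' & e & z & He & Ha & Hx).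
    apply (rel_in_cover He).
    apply rel_in_graph in Ha. apply (rel_in_le Hpf), rel_in_graph in Hx. subst z.
    apply (rel_in_comp_intro HE) with (y := b ∘ (s ∘ e)).
    - now apply rel_in_graph.
    - apply (rel_in_le Hfp), rel_in_graph. now rewrite <- Hx, !comp_assoc, Hab. }
  destruct (@equivalence_reflects (@bhom (Rel HE) T U) _ _ (graph a) (graph b) (Heq T)) as [h].
  - exact (exist _ H (@Rel_hom_irrelevance _ _ _ _ _ _ _)).
  - exact h.
Qed.

(** Supplies the hypothesis [Hu] with [f := rel2 u]: equations between arrows into [t] are
    automatic. *)
Lemma rel_from_terminal_in {t X T : E} (Ht : is_terminal t) (u : Relation t X)
    (z : T ~> t) (x : T ~> X) : rel_in u z x <-> exists h, rel2 u ∘ h = x.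
Proof.
  split; intros [h H]; exists h; [easy |].
  split; [apply (terminal_arrow_eq Ht) | exact H].
Qed.

Lemma rel_from_terminal_mono {t X : E} (Ht : is_terminal t) (u : Relation t X) :
  is_mono (rel2 u).
Proof.
  intros T a b. apply (rel_mono (r := u)), (terminal_arrow_eq Ht).
Qed.

End RelFacts.

Theorem proposition22 (E : Category) (HE : regular E) :
  has_tabulations_from_terminal (Rel HE) /\
  forall (I : TabTerminal (Rel HE)) (U X : E) (p : @bhom (Rel HE) U X),
    Tab I p <->
    exists f : U ~> X, is_mono f /\ @isomorphic (@bhom (Rel HE) U X) p (graph f).
Proof.
  split.
  - destruct (reg_terminal HE) as [t Ht].
    destruct (TabTerminal_of_terminal HE Ht) as [J].
    exists J. intros X u.
    pose proof (tob_is_terminal HE J) as HJ.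
    (* The second leg of [u] is itself the mono whose graph tabulates [u]. *)
    exists (rel_ob (u : Relation (tob J) X)), (graph (rel2 u)).
    exact (subobject_tabulation HE J (rel_from_terminal_mono HJ u)
             (fun T => rel_from_terminal_in HJ u (T := T))
             (rel_le_refl _) (rel_le_refl _)).
  - intros J U X p. pose proof (tob_is_terminal HE J) as HJ. split.
    + intros (u & rho & H).
      destruct (left_adjoint_is_graph HE (proj1 H)) as (f & Hpf & Hfp).
      exists f. split; [exact (tabulation_mono HE J H Hpf Hfp) |].
      exists Hpf, Hfp. split; apply Rel_hom_irrelevance.
    + intros (f & Hf & Hpf & Hfp & _).
      (* Pairing [f] with the arrow [b] to the terminal object turns the mono into a relation out of
         that object, which [p] tabulates. *)
      destruct (HJ U) as [b _].
      assert (Hm : jointly_mono b f) by (intros T x y _; apply Hf).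
      exists {| rel_mono := Hm |}.
      exact (subobject_tabulation HE J Hf
               (fun T => rel_from_terminal_in HJ {| rel_mono := Hm |} (T := T))
               Hpf Hfp).
Qed.
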